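(* For each prime $n \geq 3$, there exists a graph $G$ such that its square $G^2$ is (isomorphic to) the complete multipartite graph $K_{n*(2n-1)}$.
   Context: Graphs are finite and simple. The square $G^2$ of a graph $G$ is the graph with $V(G^2)=V(G)$ in which two distinct vertices $x,y$ are adjacent if and only if the distance between $x$ and $y$ in $G$ is at most $2$. $K_{n*r}$ denotes the complete multipartite graph with $r$ partite sets, each of size $n$. *)

(* Defs.v *)
From mathcomp Require Import all_boot.

Set Implicit Arguments.
Unset Strict Implicit.
Unset Printing Implicit Defensive.

Record sgraph := SGraph {
  vertex :> finType;
  adj : rel vertex;
  adj_sym : symmetric adj;
  adj_irr : irreflexive adj }.

Arguments adj {G} x y : rename.

Definition has_path (G : sgraph) (x y : G) (k : nat) : bool :=
  [exists p : k.-tuple G,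
     [&& path adj x p, last x p == y & uniq (x :: p)]].

(* Length of a shortest path, None when y is unreachable from x. The filtered
   list is increasing, and every path has fewer than #|G| edges. *)
Definition gdist (G : sgraph) (x y : G) : option nat :=
  ohead [seq k <- iota 0 #|G| | has_path x y k].

Definition square_adj (G : sgraph) : rel G := fun x y =>
  (x != y) && (if gdist x y is Some d then d <= 2 else false).

Lemma has_path_sym (G : sgraph) (x y : G) k : has_path x y k = has_path y x k.
Proof.
suff imp (u v : G) : has_path u v k -> has_path v u k.
  by apply/idP/idP; apply: imp.
case/existsP=> p /and3P[up /eqP <- uu].
have szq : size (rev (belast u p)) == k by rewrite size_rev size_belast size_tuple.
have Er : last u p :: rev (belast u p) = rev (u :: p).
  by rewrite [in RHS]lastI rev_rcons.
apply/existsP; exists (Tuple szq) => /=; apply/and3P; split.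
- by rewrite rev_path (@eq_path _ _ adj) // => a b; rewrite adj_sym.
- by rewrite -[last _ _]/(last u (last u p :: _)) Er rev_cons last_rcons.
- by move: (rev_uniq (u :: p)); rewrite -Er /= => ->.
Qed.

Lemma gdist_sym (G : sgraph) (x y : G) : gdist x y = gdist y x.
Proof. by congr ohead; apply: eq_filter => k; apply: has_path_sym. Qed.

Lemma square_adj_sym (G : sgraph) : symmetric (@square_adj G).
Proof. by move=> x y; rewrite /square_adj eq_sym gdist_sym. Qed.

Lemma square_adj_irr (G : sgraph) : irreflexive (@square_adj G).
Proof. by move=> x; rewrite /square_adj eqxx. Qed.

Definition square (G : sgraph) : sgraph :=
  SGraph (@square_adj_sym G) (@square_adj_irr G).

(* The vertex (i, j) is the j-th vertex of the i-th partite set. *)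
Definition multipartite_adj (n r : nat) : rel ('I_r * 'I_n) :=
  fun u v => u.1 != v.1.

Lemma multipartite_adj_sym n r : symmetric (@multipartite_adj n r).
Proof. by move=> u v; rewrite /multipartite_adj eq_sym. Qed.

Lemma multipartite_adj_irr n r : irreflexive (@multipartite_adj n r).
Proof. by move=> u; rewrite /multipartite_adj eqxx. Qed.

(* K_{n*r}: r partite sets, each of size n. *)
Definition complete_multipartite (n r : nat) : sgraph :=
  SGraph (@multipartite_adj_sym n r) (@multipartite_adj_irr n r).

Definition isomorphic (G H : sgraph) : Prop :=
  exists2 f : G -> H, bijective f & forall x y : G, adj (f x) (f y) = adj x y.

(* Main.v *)
Require Import Defs.
From mathcomp Require Import all_boot.
From mathcomp Require Import all_algebra ring.

(** Let F be the field with n elements. The vertices of G are the n^2 points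
    (x, y) of the affine plane over F together with its n(n - 1) lines
    y = m x + b of nonzero slope. A point is joined to the lines through it,
    and two points on a common horizontal line are joined. The partite sets
    are the n vertical lines (as sets of points) and the n - 1 parallel classes
    of nonzero slope. Two points with distinct abscissae lie on a common line,
    which is horizontal or a vertex of G; two lines of distinct slopes meet; and a
    line of nonzero slope has a point at every height, so it is within
    distance 2 of every point. On the other hand neither two points with the
    same abscissa nor two parallel lines have a common neighbour. *)

Set Implicit Arguments.
Unset Strict Implicit.
Unset Printing Implicit Defensive.

Import GRing.Theory.

Lemma has_path_ltn_card (G : sgraph) (x y : G) k : has_path x y k -> k < #|G|.
Proof.
case/existsP=> p /and3P[_ _ up].
by have := max_card (mem (x :: p)); rewrite (card_uniqP up) /= size_tuple.
Qed.

Lemma gdist_leP (G : sgraph) (x y : G) m :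
  reflect (exists2 k, k <= m & has_path x y k)
          (if gdist x y is Some d then d <= m else false).
Proof.
rewrite /gdist; set s := filter _ _.
have mem_s k : (k \in s) = has_path x y k.
  rewrite mem_filter mem_iota /= add0n.
  by case hp: (has_path x y k) => //=; rewrite (has_path_ltn_card hp).
have : sorted leq s by apply/(sorted_filter leq_trans)/iota_sorted.
case: s mem_s => [|d s] mem_s /= sorted_s.
  by constructor=> -[k _]; rewrite -mem_s.
apply: (iffP idP) => [le_dm|[k le_km]].
  by exists d; rewrite -?mem_s ?mem_head.
rewrite -mem_s inE => /predU1P[<- //|ks].
have /allP/(_ k ks) le_dk := order_path_min leq_trans sorted_s.
exact: leq_trans le_dk le_km.
Qed.

Lemma square_adjE (G : sgraph) (x y : G) :
  square_adj x y = (x != y) && (adj x y || [exists z, adj x z && adj z y]).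
Proof.
rewrite /square_adj; case: eqVneq => //= neq_xy.
apply/gdist_leP/orP => [[k]|[xy|/existsP[z /andP[xz zy]]]].
- case: k => [|[|[|//]]] _ /existsP[p /and3P[]].
  + by rewrite (tuple0 p) /= (negPf neq_xy).
  + by case/tupleP: p => z p; rewrite (tuple0 p) /= andbT => xz /eqP <-; left.
  + case/tupleP: p => z p; case/tupleP: p => t p.
    rewrite (tuple0 p) /= andbT => /andP[xz zt] /eqP <- _.
    by right; apply/existsP; exists z; rewrite xz.
- exists 1 => //; apply/existsP; exists [tuple y].
  by rewrite /= xy eqxx inE neq_xy.
- exists 2 => //; apply/existsP; exists [tuple z; y].
  (* [has_path] wants distinct vertices; irreflexivity separates [z] from [x] and [y]. *)
  rewrite /= xz zy eqxx !inE negb_or neq_xy !andbT /=.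
  apply/andP; split; first by apply: contraTneq xz => ->; rewrite adj_irr.
  by apply: contraTneq zy => ->; rewrite adj_irr.
Qed.

Section AffineGraph.

Variable F : finFieldType.
Local Open Scope ring_scope.

(** Indexes the partite sets: a vertical line by its abscissa, a parallel class by its slope. The
    first component of a vertex is then its partite set. *)
Definition affine_class : finType := (F + {m : F | m != 0})%type.

(* [(inl x, y)] is the point (x, y), and [(inr m, b)] is the line
   y = m x + b. *)
Definition affine_adj : rel (affine_class * F) := fun u v =>
  match u, v with
  | (inl x, y), (inl x', y') => (x != x') && (y == y')
  | (inl x, y), (inr m, b) | (inr m, b), (inl x, y) => y == val m * x + b
  | (inr _, _), (inr _, _) => false
  end.

Lemma affine_adj_sym : symmetric affine_adj.
Proof. by move=> [[x|m] y] [[x'|m'] y'] //=; rewrite eq_sym [y == y']eq_sym. Qed.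

Lemma affine_adj_irr : irreflexive affine_adj.
Proof. by move=> [[x|m] y] //=; rewrite eqxx. Qed.

Definition affine_graph : sgraph := SGraph affine_adj_sym affine_adj_irr.

Lemma affine_common_nbr (u v : affine_graph) :
  u.1 != v.1 -> adj u v || [exists z, adj u z && adj z v].
Proof.
have point_line (y b : F) (m : {m : F | m != 0}) :
    exists x', y == val m * x' + b.
  exists ((y - b) / val m); apply/eqP.
  by field; apply: (valP m).
case: u v => [[x|m] y] [[x'|m'] y'] /= neq_uv.
- have {}neq_uv : x != x' by apply: contraNneq neq_uv => ->.
  case: (eqVneq y y') => [_|neq_y]; first by rewrite neq_uv.
  have dx : x - x' != 0 by rewrite subr_eq0.
  have dy : (y - y') / (x - x') != 0.
    by rewrite mulf_neq0 ?invr_neq0 ?subr_eq0.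
  apply/orP; right; apply/existsP.
  pose m : {m : F | m != 0} := exist (fun t => t != 0) _ dy.
  (* The line through both points; its slope is nonzero because [y != y']. *)
  exists (inr m, y - (y - y') / (x - x') * x) => /=.
  by apply/andP; split; apply/eqP; field.
- have [x1 on_line] := point_line y y' m'.
  case: (eqVneq x x1) => [->|neq_x]; first by rewrite on_line.
  apply/orP; right; apply/existsP; exists (inl x1, y).
  by rewrite /= neq_x eqxx.
- have [x1 on_line] := point_line y' y m.
  case: (eqVneq x1 x') => [<-|neq_x]; first by rewrite on_line.
  apply/orP; right; apply/existsP; exists (inl x1, y').
  by rewrite /= neq_x eqxx on_line.
- have dm : val m - val m' != 0.
    by rewrite subr_eq0 (inj_eq val_inj); apply: contraNneq neq_uv => ->.
  (* Here [y] and [y'] are intercepts; the witness is where the two lines meet. *)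
  apply/existsP; exists (inl ((y' - y) / (val m - val m')),
    val m * ((y' - y) / (val m - val m')) + y).
  by rewrite /= eqxx; apply/eqP; field.
Qed.

Lemma affine_class_proper (u v : affine_graph) :
  u.1 = v.1 -> adj u v || [exists z, adj u z && adj z v] -> u = v.
Proof.
case: u v => [[x|m] y] [[x'|m'] y'] //= [<-]; rewrite ?eqxx.
(* A common neighbour fixes the height of both points: [b] if it is a point, [val m * x + b] if it
   is a line. *)
- case/existsP=> -[[x1|m] b] /=.
    by case/andP=> /andP[_ /eqP->] /andP[_ /eqP->].
  by case/andP=> /eqP-> /eqP->.
- case/existsP=> -[[x1|//] y1] /= /andP[/eqP-> /eqP eq_y].
  by rewrite (addrI _ eq_y).
Qed.

Lemma affine_squareE (u v : square affine_graph) : adj u v = (u.1 != v.1).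
Proof.
rewrite [LHS]square_adjE; apply/andP/idP => [[neq_uv nbr]|neq_uv].
  by apply: contraNneq neq_uv => eq_uv; rewrite (affine_class_proper eq_uv nbr).
split; last exact: affine_common_nbr.
by apply: contraNneq neq_uv => ->.
Qed.

End AffineGraph.

Lemma card_affine_class (F : finFieldType) : #|affine_class F| = 2 * #|F| - 1.
Proof.
rewrite card_sum card_sig (cardC1 (0%R : F)) mul2n -addnn -addnBA ?subn1 //.
(* Subtraction is truncated, so regrouping needs [0 < #|F|]. *)
by apply/card_gt0P; exists 0%R.
Qed.

Lemma isomorphic_multipartite (I J : finType) (G : sgraph)
    (h : G -> I * J) n r :
  #|I| = r -> #|J| = n -> bijective h ->
  (forall x y : G, adj x y = ((h x).1 != (h y).1)) ->
  isomorphic G (complete_multipartite n r).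
Proof.
move=> <- <- bij_h adjE.
exists ((fun u => (enum_rank u.1, enum_rank u.2)) \o h) => [|x y].
  apply: bij_comp bij_h.
  exists (fun v => (enum_val v.1, enum_val v.2)) => -[i j] /=.
    by rewrite !enum_rankK.
  by rewrite !enum_valK.
by rewrite adjE /= /multipartite_adj /= (inj_eq enum_rank_inj).
Qed.

Theorem theorem2p9 (n : nat) (n_prime : prime n) (n_ge3 : 3 <= n) :
  exists G : sgraph,
    isomorphic (square G) (complete_multipartite n (2 * n - 1)).
Proof.
(* ['F_n] is built modulo [pdiv n], which is [n] by primality. *)
have cardF := card_Fp n_prime.
exists (affine_graph 'F_n).
apply: (@isomorphic_multipartite (affine_class 'F_n) 'F_n
          (square (affine_graph 'F_n)) id) => //.
- by rewrite card_affine_class cardF.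
- by exists id.
- exact: affine_squareE.
Qed.
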